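(* Let $E$ be a Banach space. Let $\rho$ be the greatest submultiplicative lattice seminorm on $\mathrm{FAfA}[E]$ such that $\rho(\delta_x)\le\|x\|$ for all $x\in E$. Then \[ \ker\rho=\{\, f\in\mathrm{FAfA}[E] : f|_{B_{E^*}}=0\,\}. \]
   Context: All spaces are real. $E^*$ is the topological dual of $E$ and $B_{E^*}$ its closed unit ball. The space $\mathbb{R}^{E^*}$ of all functions $E^*\to\mathbb{R}$ carries pointwise linear operations, order and product. For $x\in E$ let $\delta_x\colon E^*\to\mathbb{R}$, $\delta_x(x^* )=x^*(x)$. $\mathrm{FAfA}[E]$ denotes the smallest linear subspace of $\mathbb{R}^{E^*}$ that contains $\{\delta_x : x\in E\}$ and is closed under the pointwise lattice operations and the pointwise product. A lattice seminorm is a seminorm $\nu$ such that $|f|\le|g|$ implies $\nu(f)\le\nu(g)$; it is submultiplicative if $\nu(fg)\le\nu(f)\nu(g)$. The seminorm $\rho$ is the pointwise supremum $\rho(f)=\sup_\nu\nu(f)$ over all submultiplicative lattice seminorms $\nu$ on $\mathrm{FAfA}[E]$ with $\nu(\delta_x)\le\|x\|$ for all $x\in E$; this supremum is finite for every $f$ and $\rho$ is itself such a seminorm. $\ker\rho=\{f:\rho(f)=0\}$. *)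

(* Defs.v *)
From HB Require Import structures.
From mathcomp Require Import all_boot all_order all_algebra.
From mathcomp Require Import all_classical all_reals all_analysis.
Set Implicit Arguments.
Unset Strict Implicit.
Unset Printing Implicit Defensive.
Import Order.TTheory GRing.Theory Num.Theory.
Import numFieldNormedType.Exports.
Local Open Scope classical_set_scope.
Local Open Scope ring_scope.

Record dual (R : realType) (E : normedModType R) := Dual {
  dual_fun :> {linear E -> R^o};
  dual_continuous : continuous dual_fun }.

Definition dual_norm (R : realType) (E : normedModType R) (phi : dual E) : R :=
  sup [set `|phi x| | x in [set x : E | `|x| <= 1]].

(* By continuity the supremum in dual_norm is taken over a bounded set. *)
Lemma dual_norm_has_sup (R : realType) (E : normedModType R) (phi : dual E) :
  has_sup [set `|phi x| | x in [set x : E | `|x| <= 1]].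
Proof.
split; first by exists `|phi 0|, 0 => //=; rewrite normr0.
have /linear_boundedP [r [_ H]] :=
  continuous_linear_bounded 0 (@dual_continuous _ _ phi 0).
have lt : r < `|r| + 1 by rewrite (le_lt_trans (ler_norm r)) // ltrDl.
exists (`|r| + 1) => _ [x /= x1 <-]; apply: (le_trans (H _ lt x)).
by rewrite ler_piMr // addr_ge0.
Qed.

Definition dual_ball (R : realType) (E : normedModType R) : set (dual E) :=
  [set phi | dual_norm phi <= 1].

Definition delta (R : realType) (E : normedModType R) (x : E) : dual E -> R :=
  fun phi => phi x.

Record lattice_subalgebra (R : realType) (T : Type) (A : set (T -> R)) : Prop :=
  LatticeSubalgebra {
    lsa0 : A (cst 0);
    lsaD : forall f g, A f -> A g -> A (f \+ g);
    lsaZ : forall (a : R) f, A f -> A (a \*o f);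
    lsa_max : forall f g, A f -> A g -> A (f \max g);
    lsa_min : forall f g, A f -> A g -> A (f \min g);
    lsaM : forall f g, A f -> A g -> A (f \* g) }.

Definition FAfA (R : realType) (E : normedModType R) : set (dual E -> R) :=
  smallest (@lattice_subalgebra R (dual E)) (range (@delta R E)).
Arguments FAfA {R} E.

(* A seminorm on a subspace A of T -> R is encoded by a total function on
   T -> R, of which only the values on A are ever constrained or used.
   Nonnegativity follows from the two axioms of seminorm_on. *)
Record seminorm_on (R : realType) (T : Type) (A : set (T -> R))
    (nu : (T -> R) -> R) : Prop := SeminormOn {
  seminormD : forall f g, A f -> A g -> nu (f \+ g) <= nu f + nu g;
  seminormZ : forall (a : R) f, A f -> nu (a \*o f) = `|a| * nu f }.

Definition lattice_seminorm_on (R : realType) (T : Type) (A : set (T -> R))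
    (nu : (T -> R) -> R) : Prop :=
  seminorm_on A nu /\
  forall f g, A f -> A g -> (forall t, `|f t| <= `|g t|) -> nu f <= nu g.

Definition submultiplicative_on (R : realType) (T : Type) (A : set (T -> R))
    (nu : (T -> R) -> R) : Prop :=
  forall f g, A f -> A g -> nu (f \* g) <= nu f * nu g.

Definition admissible (R : realType) (E : normedModType R)
    (nu : (dual E -> R) -> R) : Prop :=
  [/\ lattice_seminorm_on (FAfA E) nu, submultiplicative_on (FAfA E) nu
    & forall x : E, nu (delta x) <= `|x|].

Definition rho (R : realType) (E : normedModType R) (f : dual E -> R) : R :=
  sup [set nu f | nu in [set nu | @admissible R E nu]].

Section rho_greatest.
Context (R : realType) (E : normedModType R).
Implicit Types (f g : dual E -> R) (nu : (dual E -> R) -> R) (phi : dual E).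

Let LFAfA : lattice_subalgebra (FAfA E).
Proof.
split.
- by move=> B [[]].
- by move=> f g Af Ag B HB; apply: (lsaD HB.1); [exact: Af|exact: Ag].
- by move=> a f Af B HB; apply: (lsaZ HB.1); exact: Af.
- by move=> f g Af Ag B HB; apply: (lsa_max HB.1); [exact: Af|exact: Ag].
- by move=> f g Af Ag B HB; apply: (lsa_min HB.1); [exact: Af|exact: Ag].
- by move=> f g Af Ag B HB; apply: (lsaM HB.1); [exact: Af|exact: Ag].
Qed.

Let Adelta (x : E) : FAfA E (delta x).
Proof. by move=> B [_]; apply; exists x. Qed.

Let Aabs f : FAfA E f -> FAfA E (f \max (-1 \*o f)).
Proof. by move=> Af; apply: (lsa_max LFAfA) => //; exact: (lsaZ LFAfA). Qed.

Let absE f phi : (f \max (-1 \*o f)) phi = `|f phi|.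
Proof. by rewrite /= mulN1r maxrN. Qed.

Lemma admissible_ge0 nu f : admissible nu -> FAfA E f -> 0 <= nu f.
Proof.
case=> -[[nD nZ] _] _ _ Af.
have := nD f (-1 \*o f) Af (lsaZ LFAfA _ Af).
rewrite (nZ _ _ Af) normrN normr1 mul1r.
have -> : f \+ (-1 \*o f) = (0 \*o f).
  by apply/funext => phi /=; rewrite mulN1r subrr mul0r.
by rewrite (nZ _ _ Af) normr0 mul0r -mulr2n pmulrn_lge0.
Qed.

Lemma rho_bounded f : FAfA E f ->
  has_ubound [set nu f | nu in [set nu | @admissible R E nu]].
Proof.
move=> Af.
pose B := [set h : dual E -> R | FAfA E h /\
  exists C, forall nu, admissible nu -> nu h <= C].
suff [_ [C HC]] : B f by exists C => _ [nu /= Hnu <-]; exact: HC.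
have LUB f1 g1 h : FAfA E f1 -> FAfA E g1 -> FAfA E h ->
    (forall phi, `|h phi| <= `|f1 phi| + `|g1 phi|) ->
    (exists C, forall nu, admissible nu -> nu f1 <= C) ->
    (exists C, forall nu, admissible nu -> nu g1 <= C) ->
    exists C, forall nu, admissible nu -> nu h <= C.
  move=> Af1 Ag1 Ah le [C1 H1] [C2 H2]; exists (C1 + C2) => nu Hnu.
  have [[[nD nZ] nL] _ _] := Hnu.
  apply: (@le_trans _ _ (nu ((f1 \max (-1 \*o f1)) \+ (g1 \max (-1 \*o g1))))).
    apply: nL => //; first by apply: (lsaD LFAfA); exact: Aabs.
    move=> phi; apply: (le_trans (le phi)).
    by rewrite /= !mulN1r !maxrN ler_norm.
  apply: (le_trans (nD _ _ (Aabs Af1) (Aabs Ag1))); apply: lerD.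
    apply: le_trans (H1 _ Hnu); apply: nL => //; first exact: Aabs.
    by move=> phi; rewrite absE normr_id.
  apply: le_trans (H2 _ Hnu); apply: nL => //; first exact: Aabs.
  by move=> phi; rewrite absE normr_id.
apply: (Af B); split; last first.
  move=> _ [x _ <-]; split; first exact: Adelta.
  by exists `|x| => nu [_ _]; exact.
split.
- split; first exact: (lsa0 LFAfA).
  exists 0 => nu [[[nD nZ] _] _ _].
  have -> : cst 0 = 0 \*o (cst 0 : dual E -> R).
    by apply/funext => phi /=; rewrite mul0r.
  by rewrite nZ ?normr0 ?mul0r //; exact: (lsa0 LFAfA).
- move=> f1 g1 [Af1 C1] [Ag1 C2].
  have Ah := lsaD LFAfA Af1 Ag1; split=> //.
  by apply: (LUB _ _ _ Af1 Ag1) => // phi; exact: ler_normD.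
- move=> a f1 [Af1 [C1 H1]]; split; first exact: (lsaZ LFAfA).
  exists (`|a| * C1) => nu Hnu; have [[[_ nZ] _] _ _] := Hnu.
  by rewrite nZ // ler_wpM2l // H1.
- move=> f1 g1 [Af1 C1] [Ag1 C2].
  have Ah := lsa_max LFAfA Af1 Ag1; split=> //.
  apply: (LUB _ _ _ Af1 Ag1) => // phi /=.
  by case: (leP (f1 phi) (g1 phi)) => _; rewrite ?lerDl ?lerDr.
- move=> f1 g1 [Af1 C1] [Ag1 C2].
  have Ah := lsa_min LFAfA Af1 Ag1; split=> //.
  apply: (LUB _ _ _ Af1 Ag1) => // phi /=.
  by case: (leP (f1 phi) (g1 phi)) => _; rewrite ?lerDl ?lerDr.
- move=> f1 g1 [Af1 [C1 H1]] [Ag1 [C2 H2]]; split; first exact: (lsaM LFAfA).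
  exists (C1 * C2) => nu Hnu; have [_ nM _] := Hnu.
  apply: (le_trans (nM _ _ Af1 Ag1)).
  by apply: ler_pM; rewrite ?admissible_ge0 // ?H1 ?H2.
Qed.

Lemma admissible0 : @admissible R E (cst 0).
Proof.
split; last by move=> x; exact: normr_ge0.
- by split => //; split => [f g _ _|a f _] /=; rewrite ?addr0 ?mulr0.
- by move=> f g _ _ /=; rewrite mulr0.
Qed.

Lemma rho_ub nu f : admissible nu -> FAfA E f -> nu f <= rho f.
Proof.
by move=> Hnu Af; apply: ub_le_sup; [exact: rho_bounded|exists nu].
Qed.

Lemma rho_le f c : (forall nu, admissible nu -> nu f <= c) -> rho f <= c.
Proof.
move=> H; apply: ge_sup; first by exists 0, (cst 0) => //; exact: admissible0.
by move=> _ [nu /= Hnu <-]; exact: H.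
Qed.

Lemma rho_admissible : @admissible R E (@rho R E).
Proof.
have rhoZ (a : R) f : FAfA E f -> rho (a \*o f) <= `|a| * rho f.
  move=> Af; apply: rho_le => nu Hnu; have [[[_ nZ] _] _ _] := Hnu.
  by rewrite nZ // ler_wpM2l // rho_ub.
split; last by move=> x; apply: rho_le => nu [].
- split; last first.
    move=> f g Af Ag le; apply: rho_le => nu Hnu; have [[_ nL] _ _] := Hnu.
    by apply: le_trans (rho_ub Hnu Ag); exact: nL.
  split=> [f g Af Ag|a f Af].
    apply: rho_le => nu Hnu; have [[[nD _] _] _ _] := Hnu.
    by apply: le_trans (nD _ _ Af Ag) _; rewrite lerD // rho_ub.
  apply/eqP; rewrite eq_le rhoZ //=.
  have [->|a0] := eqVneq a 0.
    by rewrite normr0 mul0r (le_trans _ (rho_ub admissible0 _)) //;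
      exact: (lsaZ LFAfA).
  have {1}-> : f = a^-1 \*o (a \*o f).
    by apply/funext => phi /=; rewrite mulKf.
  rewrite mulrC -ler_pdivlMr ?normr_gt0 // mulrC -normfV rhoZ //.
  exact: (lsaZ LFAfA).
- move=> f g Af Ag; apply: rho_le => nu Hnu; have [_ nM _] := Hnu.
  apply: le_trans (nM _ _ Af Ag) _.
  by apply: ler_pM; rewrite ?admissible_ge0 // rho_ub.
Qed.

(* In particular, the real-valued supremum defining rho is never the default
   value that sup returns on unbounded sets. *)
Theorem rho_greatest : @admissible R E (@rho R E) /\
  forall nu f, admissible nu -> FAfA E f -> nu f <= rho f.
Proof. by split; [exact: rho_admissible|move=> nu f; exact: rho_ub]. Qed.

End rho_greatest.

(* Main.v *)
Require Import Defs.
From HB Require Import structures.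
From mathcomp Require Import all_boot all_order all_algebra.
From mathcomp Require Import all_classical all_reals all_analysis.
From mathcomp Require Import ring lra.
Set Implicit Arguments.
Unset Strict Implicit.
Import Order.TTheory GRing.Theory Num.Theory.
Import numFieldNormedType.Exports.
Local Open Scope classical_set_scope.
Local Open Scope ring_scope.

(** One inclusion is the fact that [f |-> `|f phi|] is an admissible seminorm
    for every [phi] in the dual ball, hence is dominated by [rho].

    Conversely, let [f] vanish on the dual ball and let [nu] be admissible; the
    claim is [nu f = 0], and only finitely many vectors matter. An element of
    the algebra depends on finitely many coordinates [phi x], [x \in xs], and
    does so in a locally Lipschitz way ([FAfA_locally_lipschitz]). If
    [`|phi v| <= q * `|v|] on the span of [xs] with [q] close to [1], then by
    the Hahn-Banach theorem [phi] agrees on that span with [q *: psi] for some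
    [psi] in the dual ball. As [f psi = 0], the Lipschitz estimate between
    [phi] and [psi] gives [`|f phi| <= e * w phi], where [w phi] is the sum of
    the [`|phi x|] and [e] tends to [0] with [q - 1]. The unit ball of the span
    is totally bounded, so the bound on [phi] can be tested on finitely many
    [ys] of norm at most [1] ([vanishing_estimate]).

    Therefore [g := (`|f| - e w)^+] vanishes wherever all [`|phi y|] are below
    some [q0 > 1]. This forces [nu g = 0] ([admissible_eq0_far]): from
    [q0 ^+ n * `|g| <= \sum_(y <- ys) `|delta y ^+ n * g|] and
    [nu (delta y) <= 1] one gets [q0 ^+ n * nu g <= size ys * nu g] for all [n].
    Since [`|f| <= g + e w], it follows that [nu f <= e * nu w] for every
    [e > 0]. All elements of the algebra vanish at the functional [0], so it
    contains no nonzero constant; this is why [f] is compared with multiples of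
    [w] and not with constants. *)

(** * The Hahn-Banach theorem *)

(** Epigraphs of sublinear functionals are such cones. Ordering functionals by
    their epigraphs turns a minimal sublinear functional into a maximal cone,
    and unions of chains of cones are again cones, so that Zorn's lemma applies
    without any infimum of functionals. *)
Record epigraph_cone (R : realType) (E : lmodType R) (A : set (E * R)) : Prop :=
  EpigraphCone {
    coneD : forall x s y t, A (x, s) -> A (y, t) -> A (x + y, s + t);
    coneZ : forall (k : R) x s, 0 < k -> A (x, s) -> A (k *: x, k * s);
    cone_ge0 : forall t, A (0, t) -> 0 <= t }.

(** The last clause is maximality in usable form: adding the ray through [(x, s)]
    to [A] keeps it a cone as soon as the points of [A] above [- x] do not
    contradict it, and then the ray is already in [A]. *)
Lemma maximal_cone (R : realType) (E : lmodType R) (C : set (E * R)) :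
  epigraph_cone C -> C (0, 0) -> exists A, [/\ epigraph_cone A, C `<=` A &
    forall x s, (forall t, A (- x, t) -> 0 <= t + s) -> A (x, s)].
Proof.
move=> coneC C0.
(* The union of the empty chain is empty, so P must hold of set0: containing C
   is only asked of nonempty sets. *)
pose P (A : set (E * R)) := epigraph_cone A /\ (A !=set0 -> C `<=` A).
have [|A [[coneA CA] maxA]] := @Zorn_bigcup _ P.
  move=> F FP totF; split; first split.
  - move=> x s y t [X FX Xs] [Y FY Yt].
    have [XY|YX] := totF _ _ FX FY.
      by exists Y => //; apply: (coneD (FP _ FY).1) => //; exact: XY.
    by exists X => //; apply: (coneD (FP _ FX).1) => //; exact: YX.
  - by move=> k x s k0 [X FX Xs]; exists X => //; exact: (coneZ (FP _ FX).1).
  - by move=> t [X FX Xt]; exact: (cone_ge0 (FP _ FX).1).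
  - move=> [u [X FX Xu]] v Cv; exists X => //.
    by apply: (FP _ FX).2 => //; exists u.
have {}CA : C `<=` A.
  have [A0|/set0P] := eqVneq A set0; last by move=> /CA.
  exfalso; apply: (maxA C); last by split=> // _; exact: subset_refl.
  by rewrite A0; split=> [//|/(_ _ C0)].
have A0 : A (0, 0) by exact: CA.
exists A; split=> // x s xs; apply: contrapT => nAxs.
pose B := [set u : E * R | exists2 k : R, 0 <= k & A (u.1 - k *: x, u.2 - k * s)].
apply: (maxA B).
  split; last first.
    move=> /(_ (x, s)); apply: contra_not nAxs; apply.
    by exists 1 => //=; rewrite scale1r mul1r !subrr.
  by move=> [y t] Ayt; exists 0 => //=; rewrite scale0r mul0r !subr0.
split; last first.
  move=> _ [y t] /CA Ayt; exists 0 => //=.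
  by rewrite scale0r mul0r !subr0.
split.
- move=> y t z u [k /= k0 Ak] [l /= l0 Al]; exists (k + l); first exact: addr_ge0.
  rewrite /= scalerDl mulrDl (opprD (k *: x)) (opprD (k * s)).
  by rewrite (addrACA y) (addrACA t); exact: (coneD coneA).
- move=> k y t k0 [l /= l0 Al]; exists (k * l); first by rewrite mulr_ge0 // ltW.
  have := coneZ coneA k0 Al => /=.
  by rewrite scalerBr mulrBr scalerA mulrA.
- move=> t [k /=]; rewrite le_eqVlt => /predU1P[<-|k0].
    by rewrite scale0r mul0r !subr0; exact: (cone_ge0 coneA).
  rewrite sub0r => At.
  have ki0 : 0 < k^-1 by rewrite invr_gt0.
  have := coneZ coneA ki0 At.
  rewrite scalerN scalerA mulVf ?gt_eqF // scale1r => /xs.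
  rewrite mulrBr mulKf ?gt_eqF // subrK.
  by rewrite pmulr_rge0.
Qed.

(** Start from the epigraph of the infimal convolution of [p] with [l] on [V]. A
    maximal cone containing it is the region above the graph of a linear
    functional: above both [x] and [- x] its lower boundary is attained, at
    opposite heights. *)
Lemma hahn_banach (R : realType) (E : lmodType R) (p : E -> R)
    (V : set E) (l : E -> R) :
  (forall x y, p (x + y) <= p x + p y) ->
  (forall (k : R) x, 0 <= k -> p (k *: x) = k * p x) ->
  V 0 -> (forall a x y, V x -> V y -> V (a *: x + y)) ->
  (forall a x y, V x -> V y -> l (a *: x + y) = a * l x + l y) ->
  (forall v, V v -> l v <= p v) ->
  exists g : {linear E -> R^o},
    (forall x, g x <= p x) /\ (forall v, V v -> g v = l v).
Proof.
move=> pD pZ V0 VP lP lp.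
have l0 : l 0 = 0.
  have := lP 1 0 0 V0 V0.
  by rewrite scale1r addr0 mul1r -[X in X = _]addr0 => /addrI.
have lZ a x : V x -> l (a *: x) = a * l x.
  by move=> Vx; have := lP a x 0 Vx V0; rewrite l0 !addr0.
have VZ a x : V x -> V (a *: x).
  by move=> Vx; have := VP a x 0 Vx V0; rewrite addr0.
pose C := [set u : E * R | exists2 v, V v & p (u.1 - v) <= u.2 - l v].
have coneC : epigraph_cone C.
  split.
  - move=> x s y t [v /= Vv pv] [w /= Vw pw]; exists (v + w).
      by rewrite -[v]scale1r; exact: VP.
    rewrite /= -{2}[v]scale1r lP // mul1r opprD addrACA.
    by apply: (le_trans (pD _ _)); lra.
  - move=> k x s k0 [v /= Vv pv]; exists (k *: v); first exact: VZ.
    rewrite /= lZ // -scalerBr -mulrBr pZ; last exact: ltW.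
    by rewrite ler_pM2l.
  - move=> t [v /= Vv]; rewrite sub0r => pv.
    have := lp _ (VZ (-1) _ Vv); rewrite lZ // scaleN1r; lra.
have p0 : p 0 = 0 by rewrite -(scale0r 0) pZ // mul0r.
have C0 : C (0, 0) by exists 0; rewrite //= l0 !subr0 p0.
have [A [coneA CA absorbA]] := maximal_cone coneC C0.
have Ap x : A (x, p x) by apply: CA; exists 0; rewrite //= l0 !subr0.
pose g x : R^o := inf [set t | A (x, t)].
have bnd x t u : A (x, t) -> A (- x, u) -> 0 <= t + u.
  move=> At Au; apply: (cone_ge0 coneA).
  by rewrite -(subrr x); exact: (coneD coneA).
have lbA x : has_lbound [set t | A (x, t)].
  exists (- p (- x)) => t At; have := bnd _ _ _ At (Ap (- x)); lra.
have gle x t : A (x, t) -> g x <= t by move=> At; apply: ge_inf.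
have Ag x : A (x, g x).
  apply: absorbA => t At; rewrite -lerBlDl sub0r.
  apply: lb_le_inf; first by exists (p x); exact: Ap.
  move=> u /= Au; have := bnd _ _ _ Au At; lra.
have AgN x : A (- x, - g x).
  by apply: absorbA => t; rewrite opprK => /gle; rewrite subr_ge0.
have gE x t : A (x, t) -> A (- x, - t) -> g x = t.
  move=> At ANt; apply/eqP; rewrite eq_le gle //=.
  by have := bnd _ _ _ (Ag x) ANt; rewrite subr_ge0.
have gN x : g (- x) = - g x by apply: gE => //; rewrite !opprK; exact: Ag.
have gpZ k x : 0 < k -> g (k *: x) = k * g x.
  move=> k0; apply: gE; first exact: (coneZ coneA).
  by rewrite -scalerN -mulrN; exact: (coneZ coneA).
have g0 : g 0 = 0 by apply: gE; rewrite ?oppr0; exact: CA.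
have gZ k x : g (k *: x) = k * g x.
  have [k0|k0|->] := ltgtP k 0.
  - by rewrite -[k]opprK scaleNr gN gpZ ?oppr_gt0 // !mulNr.
  - exact: gpZ.
  - by rewrite scale0r mul0r g0.
have gD x y : g (x + y) = g x + g y.
  apply: gE; first exact: (coneD coneA).
  by rewrite !opprD; exact: (coneD coneA).
have glin : linear g by move=> a x y; rewrite gD gZ.
pose gL : {linear E -> R^o} := HB.pack g (GRing.isLinear.Build R E R^o *:%R g glin).
have gV v : V v -> g v <= l v.
  by move=> Vv; apply/gle/CA; exists v; rewrite //= !subrr p0.
exists gL; split=> [x|v Vv]; first exact: gle.
apply/eqP; rewrite eq_le /= gV //=.
by have := gV _ (VZ (-1) _ Vv); rewrite gZ lZ // !mulN1r lerN2.
Qed.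
(** * Total boundedness in finitely generated subspaces *)

Fixpoint lin_span (R : realType) (E : lmodType R) (xs : seq E) : set E :=
  if xs is x :: xs' then [set u | exists t : R, lin_span xs' (u - t *: x)]
  else [set 0].

Lemma lin_span0 (R : realType) (E : lmodType R) (xs : seq E) : lin_span xs 0.
Proof. by elim: xs => //= x xs IH; exists 0; rewrite scale0r subr0. Qed.

Lemma lin_spanP (R : realType) (E : lmodType R) (xs : seq E) (a : R) (u v : E) :
  lin_span xs u -> lin_span xs v -> lin_span xs (a *: u + v).
Proof.
elim: xs u v => [|x xs IH] u v /=; first by move=> -> ->; rewrite scaler0 addr0.
move=> [s us] [t vt]; exists (a * s + t).
by rewrite scalerDl -scalerA opprD addrACA -scalerBr; exact: IH.
Qed.

Lemma mem_lin_span (R : realType) (E : lmodType R) (xs : seq E) (x : E) :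
  x \in xs -> lin_span xs x.
Proof.
elim: xs => //= y xs IH; rewrite in_cons => /predU1P[->|/IH xs_x].
  by exists 1; rewrite scale1r subrr; exact: lin_span0.
by exists 0; rewrite scale0r subr0.
Qed.

(** The approximating vectors may lie outside [A]; [totally_bounded_inner] moves
    them into [A]. *)
Definition totally_bounded (R : realType) (E : normedModType R) (A : set E) :=
  forall d : R, 0 < d -> exists ys : seq E,
    forall v, A v -> exists2 y, y \in ys & `|v - y| <= d.

Lemma totally_bounded_inner (R : realType) (E : normedModType R) (A : set E)
    (d : R) : totally_bounded A -> 0 < d ->
  exists ys : seq E, (forall y, y \in ys -> A y) /\
    forall v, A v -> exists2 y, y \in ys & `|v - y| <= d.
Proof.
move=> tbA d0; have [|ys ysA] := tbA (d / 2); first by rewrite divr_gt0.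
pose near y := xget 0 [set v | A v /\ `|v - y| <= d / 2].
exists [seq y <- [seq near y | y <- ys] | `[< A y >]]; split.
  by move=> y; rewrite mem_filter => /andP[/asboolP].
move=> v Av; have [y ys_y vy] := ysA v Av.
have [Ay yy] : A (near y) /\ `|near y - y| <= d / 2.
  by rewrite /near; case: xgetP => [_ -> //|/(_ v)[]].
exists (near y); first by rewrite mem_filter map_f // andbT; exact/asboolP.
by rewrite [d]splitr (le_trans (ler_distD y _ _)) // lerD // distrC.
Qed.

Lemma totally_bounded_itv (R : realType) (r d : R) : 0 < d ->
  exists ts : seq R, forall t, `|t| <= r -> exists2 s, s \in ts & `|t - s| <= d.
Proof.
move=> d0; pose s_ k := k%:R * d - r.
exists [seq s_ k | k <- iota 0 (Num.truncn ((r + r) / d)).+1] => t.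
rewrite ler_norml => /andP[rt tr]; pose k := Num.truncn ((t + r) / d).
have /truncn_itv/andP[k1 k2] : 0 <= (t + r) / d.
  by apply: divr_ge0; [lra | exact: ltW].
exists (s_ k); first apply: map_f.
  rewrite mem_iota add0n ltnS /=; apply: le_truncn.
  by rewrite ler_pM2r ?invr_gt0 // lerD2r.
move: k1 k2; rewrite -/k ler_pdivlMr // ltr_pdivrMr // -natr1 mulrDl mul1r.
by rewrite ler_norml /s_; move: (k%:R * d) => kd k1 k2; lra.
Qed.

(** By induction on the generators. If [x] has positive distance [c] to the span
    of the others, the coefficient of [x] is at most [r / c] on the ball, and a
    net of the interval combines with a net of a larger ball. Otherwise [x] is a
    limit of vectors of that span, so every vector of the ball can be moved into
    it by a small perturbation. *)
Lemma lin_span_ball_totally_bounded (R : realType) (E : normedModType R)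
    (xs : seq E) (r : R) : totally_bounded [set v | lin_span xs v /\ `|v| <= r].
Proof.
elim: xs r => [|x xs IH] r d d0.
  by exists [:: 0] => v /= [-> _]; exists 0; rewrite ?mem_head // subrr normr0 ltW.
have d20 : 0 < d / 2 by rewrite divr_gt0.
have [[c c0 cV]|near] := pselect (exists2 c : R, 0 < c &
    forall v, lin_span xs v -> c <= `|x - v|).
  have [ys ysP] := IH (r + r / c * `|x|) (d / 2) d20.
  have x1 : 0 < 1 + `|x| by rewrite ltr_pwDl.
  have [|ts tsP] := @totally_bounded_itv R (r / c) (d / 2 / (1 + `|x|)).
    by rewrite divr_gt0.
  exists [seq y + s *: x | y <- ys, s <- ts] => u [[t ut] ur].
  have tr : `|t| <= r / c.
    have [->|t0] := eqVneq t 0.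
      by rewrite normr0 divr_ge0 ?(le_trans _ ur) // (ltW c0).
    rewrite ler_pdivlMr // (le_trans _ ur) //.
    have := cV _ (lin_spanP (- t^-1) ut (lin_span0 _)).
    rewrite addr0 scaleNr opprK scalerBr scalerA mulVf // scale1r addrC subrK.
    by rewrite normrZ normfV ler_pdivlMl // normr_gt0.
  have [|y ys_y uy] := ysP (u - t *: x).
    split=> //; rewrite (le_trans (ler_normB _ _)) // lerD // normrZ.
    by rewrite ler_wpM2r.
  have [s ts_s st] := tsP t tr.
  exists (y + s *: x); first exact: allpairs_f.
  rewrite [d]splitr -[u](subrK (t *: x)) opprD addrACA -scalerBl.
  rewrite (le_trans (ler_normD _ _)) // lerD // normrZ.
  move: st; rewrite ler_pdivlMr //; apply: le_trans.
  by rewrite ler_wpM2l // lerDr.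
have [ys ysP] := IH (r + d / 2) (d / 2) d20.
exists ys => u [[t ut] ur].
have t1 : 0 < 1 + `|t| by rewrite ltr_pwDl.
have [z xs_z xz] : exists2 z, lin_span xs z & `|x - z| < d / 2 / (1 + `|t|).
  apply: contrapT => far; apply: near; exists (d / 2 / (1 + `|t|)).
    by rewrite divr_gt0.
  by move=> v xs_v; rewrite leNgt; apply/negP => xv; apply: far; exists v.
have txz : `|t *: (x - z)| <= d / 2.
  move: xz; rewrite ltr_pdivlMr // => /ltW; apply: le_trans.
  by rewrite normrZ mulrC ler_wpM2l // lerDr.
have [|y ys_y uy] := ysP (u - t *: (x - z)).
  split; last by rewrite (le_trans (ler_normB _ _)) // lerD.
  by rewrite scalerBr opprB addrCA; exact: lin_spanP.
exists y => //; rewrite [d]splitr -[u](subrK (t *: (x - z))) addrAC.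
by rewrite (le_trans (ler_normD _ _)) // lerD.
Qed.
(** * Norming the restriction of a functional to a finite-dimensional subspace *)

Lemma dual_ballP (R : realType) (E : normedModType R) (phi : dual E) :
  dual_ball phi <-> forall x, `|phi x| <= `|x|.
Proof.
split=> [ball_phi x|phi_le]; last first.
  apply: ge_sup; first exact: (dual_norm_has_sup phi).1.
  by move=> _ [x /= x1 <-]; exact: le_trans x1.
have [->|x0] := eqVneq x 0; first by rewrite linear0 !normr0.
have nx0 : 0 < `|x| by rewrite normr_gt0.
have : `|phi (`|x|^-1 *: x)| <= 1.
  apply: le_trans ball_phi; apply: ub_le_sup; first exact: (dual_norm_has_sup phi).2.
  by exists (`|x|^-1 *: x) => //=; rewrite normrZ normfV normr_id mulVf ?gt_eqF.
by rewrite linearZ normrM normfV normr_id ler_pdivrMl // mulr1.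
Qed.

(** For a [d]-net [ys] of the unit ball of the span, the norm [s] of the
    restriction of [phi] satisfies [s <= q0 + s * d]. With [q0] strictly between
    [1] and [q], the choice [d := 1 - q0 / q] yields [s <= q]. *)
Lemma lin_span_norming (R : realType) (E : normedModType R) (xs : seq E) (q : R) :
  1 < q -> exists q0 (ys : seq E), [/\ 1 < q0, forall y, y \in ys -> `|y| <= 1 &
    forall phi : dual E, (forall y, y \in ys -> `|phi y| < q0) ->
      forall v, lin_span xs v -> `|phi v| <= q * `|v|].
Proof.
move=> q1; pose q0 := (1 + q) / 2; pose d := 1 - q0 / q.
have q_gt0 : 0 < q by lra.
have q01 : 1 < q0 by rewrite /q0; lra.
have d0 : 0 < d by rewrite subr_gt0 ltr_pdivrMr // mul1r /q0; lra.
have [ys [ysB ysP]] := totally_bounded_inner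
  (lin_span_ball_totally_bounded xs 1) d0.
exists q0, ys; split=> // [y /ysB[]//|phi phi_ys].
pose S := [set `|phi v| | v in [set v | lin_span xs v /\ `|v| <= 1]].
have S0 : S `|phi 0|.
  by exists 0 => //; split; [exact: lin_span0|rewrite normr0].
have hS : has_ubound S.
  have [C HC] := (dual_norm_has_sup phi).2.
  by exists C => _ [v [_ v1] <-]; apply: HC; exists v.
have phiS v : lin_span xs v -> `|phi v| <= sup S * `|v|.
  have [->|v0 xs_v] := eqVneq v 0; first by rewrite linear0 !normr0 mulr0.
  have nv0 : 0 < `|v| by rewrite normr_gt0.
  have : `|phi (`|v|^-1 *: v)| <= sup S.
    apply: ub_le_sup => //; exists (`|v|^-1 *: v) => //; split.
      by rewrite -[X in lin_span _ X]addr0; apply: lin_spanP => //; exact: lin_span0.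
    by rewrite normrZ normfV normr_id mulVf ?gt_eqF.
  by rewrite linearZ normrM normfV normr_id ler_pdivrMl // mulrC.
have S_ge0 : 0 <= sup S.
  by apply: le_trans (ub_le_sup hS S0).
have supS : sup S <= q0 + sup S * d.
  apply: ge_sup; first by exists `|phi 0|.
  move=> _ [v [xs_v v1] <-].
  have [y ys_y vy] := ysP v (conj xs_v v1).
  rewrite -[v](subrK y) linearD addrC (le_trans (ler_normD _ _)) //.
  apply: lerD; first exact/ltW/phi_ys.
  apply: (le_trans (phiS _ _)).
    by rewrite addrC -scaleN1r; apply: lin_spanP => //; case: (ysB y ys_y).
  by rewrite ler_wpM2l.
move=> v /phiS/le_trans; apply; rewrite ler_wpM2r //.
have : sup S * (q0 / q) <= q0 by rewrite /d in supS; lra.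
by rewrite mulrA ler_pdivrMr // mulrC ler_pM2l //; lra.
Qed.

(** The Hahn-Banach theorem with the norm as sublinear functional, applied to
    [phi / q] on the span. *)
Lemma dual_ball_extension (R : realType) (E : normedModType R) (xs : seq E)
    (phi : dual E) (q : R) : 0 < q ->
  (forall v, lin_span xs v -> `|phi v| <= q * `|v|) ->
  exists psi : dual E, dual_ball psi /\ forall v, lin_span xs v -> phi v = q * psi v.
Proof.
move=> q0 phi_q.
have [||||||g [g_le gV]] := @hahn_banach R E (fun x => `|x|) (lin_span xs)
    (fun x => q^-1 * phi x).
- exact: ler_normD.
- by move=> k x k0; rewrite normrZ ger0_norm.
- exact: lin_span0.
- by move=> a x y; exact: lin_spanP.
- by move=> a x y _ _; rewrite linearP mulrDr mulrCA.
- move=> v /phi_q; rewrite ler_pdivrMl //; apply: le_trans; exact: ler_norm.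
have g_norm x : `|g x| <= `|x|.
  by rewrite ler_norml g_le andbT lerNl -linearN -[`|x|]normrN g_le.
have cont_g : continuous g.
  apply: bounded_linear_continuous; apply/linear_boundedP.
  exists 1; split=> // M M1 x; apply: (le_trans (g_norm x)).
  by rewrite ler_peMl // ltW.
exists (Dual cont_g); split; first exact/dual_ballP.
by move=> v xs_v /=; rewrite gV // mulVKf ?gt_eqF.
Qed.
(** * Local Lipschitz estimates *)

Definition coord_norm (R : realType) (E : normedModType R) (xs : seq E)
    (phi : dual E) : R :=
  \sum_(x <- xs) `|phi x|.

Definition coord_dist (R : realType) (E : normedModType R) (xs : seq E)
    (phi psi : dual E) : R :=
  \sum_(x <- xs) `|phi x - psi x|.

(** The bound on the values is part of the notion because it is what makes it
    stable under products. *)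
Definition locally_lipschitz (R : realType) (E : normedModType R)
    (f : dual E -> R) : Prop :=
  exists xs : seq E, forall r : R, exists2 L : R, 0 <= L &
    forall phi psi, coord_norm xs phi <= r -> coord_norm xs psi <= r ->
      `|f phi| <= L /\ `|f phi - f psi| <= L * coord_dist xs phi psi.

Lemma coord_dist_ge0 (R : realType) (E : normedModType R) (xs : seq E)
  (phi psi : dual E) : 0 <= coord_dist xs phi psi.
Proof. by rewrite sumr_ge0. Qed.

Lemma coord_norm_ge0 (R : realType) (E : normedModType R) (xs : seq E)
  (phi : dual E) : 0 <= coord_norm xs phi.
Proof. by rewrite sumr_ge0. Qed.

(** Once the coordinates of [f] and [g] are concatenated, a single bound on
    [coord_norm] keeps both values in a bounded set, where [op] is Lipschitz. *)
Lemma locally_lipschitz_op (R : realType) (E : normedModType R)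
    (op : R -> R -> R) (f g : dual E -> R) :
  (forall L, 0 <= L -> exists2 M, 0 <= M & forall a b c d,
    `|a| <= L -> `|b| <= L -> `|c| <= L -> `|d| <= L ->
    `|op a b| <= M /\ `|op a b - op c d| <= M * (`|a - c| + `|b - d|)) ->
  locally_lipschitz f -> locally_lipschitz g ->
  locally_lipschitz (fun phi => op (f phi) (g phi)).
Proof.
move=> opP [xs fP] [ys gP]; exists (xs ++ ys) => r.
have [L L0 {}fP] := fP r; have [M M0 {}gP] := gP r.
have [N N0 {}opP] := opP (L + M) (addr_ge0 L0 M0).
exists (N + N * (L + M)); first by rewrite addr_ge0 // mulr_ge0 // addr_ge0.
move=> phi psi; rewrite /coord_norm /coord_dist !big_cat /=.
rewrite -!/(coord_norm _ _) -!/(coord_dist _ _ _) => phi_r psi_r.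
have [xsphi ysphi] : coord_norm xs phi <= r /\ coord_norm ys phi <= r.
  by split; apply: le_trans phi_r; rewrite (lerDl, lerDr) coord_norm_ge0.
have [xspsi yspsi] : coord_norm xs psi <= r /\ coord_norm ys psi <= r.
  by split; apply: le_trans psi_r; rewrite (lerDl, lerDr) coord_norm_ge0.
have [f1 f2] := fP _ _ xsphi xspsi; have [f3 _] := fP _ _ xspsi xsphi.
have [g1 g2] := gP _ _ ysphi yspsi; have [g3 _] := gP _ _ yspsi ysphi.
have [|||| op1 op2] := opP (f phi) (g phi) (f psi) (g psi); try lra.
split; first by apply: (le_trans op1); rewrite lerDl mulr_ge0 // addr_ge0.
apply: (le_trans op2); rewrite mulrDl -mulrA.
have D1 := coord_dist_ge0 xs phi psi; have D2 := coord_dist_ge0 ys phi psi.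
apply: (@le_trans _ _
    (N * ((L + M) * (coord_dist xs phi psi + coord_dist ys phi psi)))).
  rewrite ler_wpM2l // (le_trans (lerD f2 g2)) //.
  have := mulr_ge0 L0 D2; have := mulr_ge0 M0 D1; lra.
by rewrite lerDr mulr_ge0 // addr_ge0.
Qed.

Lemma FAfA_locally_lipschitz (R : realType) (E : normedModType R)
  (f : dual E -> R) : FAfA E f -> locally_lipschitz f.
Proof.
move/(_ (@locally_lipschitz R E)); apply; split; last first.
  move=> _ [x _ <-]; exists [:: x] => r; exists (1 + `|r|).
    by rewrite addr_ge0.
  move=> phi psi; rewrite /coord_norm /coord_dist !big_seq1 /delta => phi_r _.
  have r0 : r <= `|r| := ler_norm r.
  split; first by rewrite (le_trans phi_r) //; lra.
  by rewrite ler_peMl // lerDl.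
have max_lip (a b c d : R) :
    `|Num.max a b| <= `|a| + `|b| /\
    `|Num.max a b - Num.max c d| <= `|a - c| + `|b - d|.
  split; first by case: (leP a b) => _; rewrite ?lerDl ?lerDr.
  have acP := ler_norm (a - c); have acN := lerNnormlW (lexx `|a - c|).
  have bdP := ler_norm (b - d); have bdN := lerNnormlW (lexx `|b - d|).
  by rewrite ler_norml; case: (leP a b); case: (leP c d); lra.
have min_lip (a b c d : R) :
    `|Num.min a b| <= `|a| + `|b| /\
    `|Num.min a b - Num.min c d| <= `|a - c| + `|b - d|.
  split; first by case: (leP a b) => _; rewrite ?lerDl ?lerDr.
  have acP := ler_norm (a - c); have acN := lerNnormlW (lexx `|a - c|).
  have bdP := ler_norm (b - d); have bdN := lerNnormlW (lexx `|b - d|).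
  by rewrite ler_norml; case: (leP a b); case: (leP c d); lra.
have op2 (op : R -> R -> R) (f1 f2 : dual E -> R) :
    (forall a b c d, `|op a b| <= `|a| + `|b| /\
      `|op a b - op c d| <= `|a - c| + `|b - d|) ->
    locally_lipschitz f1 -> locally_lipschitz f2 ->
    locally_lipschitz (fun phi => op (f1 phi) (f2 phi)).
  move=> opP lip1 lip2; apply: locally_lipschitz_op lip1 lip2 => L L0.
  exists (1 + 2 * L); first by lra.
  move=> a b c d aL bL cL dL; have [op1 op2] := opP a b c d.
  split; first by lra.
  apply: (le_trans op2); rewrite ler_peMl ?addr_ge0 //; lra.
split.
- exists [::] => r; exists 0 => // phi psi _ _.
  by rewrite /= subrr normr0 mul0r.
- move=> f1 f2; apply: op2 => a b c d; split; first exact: ler_normD.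
  by rewrite opprD addrACA ler_normD.
- move=> a f1 lip1.
  apply: (@locally_lipschitz_op _ _ (fun s _ => a * s) _ _ _ lip1 lip1) => L L0.
  exists (`|a| * (1 + L)); first by rewrite mulr_ge0 // addr_ge0.
  move=> s s' t t' sL _ tL _; split.
    by rewrite normrM ler_wpM2l // (le_trans sL) // lerDr.
  rewrite -mulrBr normrM -mulrA ler_wpM2l //.
  rewrite (@le_trans _ _ (`|s - t| + `|s' - t'|)) //.
    by rewrite lerDl.
  by rewrite ler_peMl ?addr_ge0 // lerDl.
- by move=> f1 f2; apply: op2 => a b c d; exact: max_lip.
- move=> f1 f2; apply: op2 => a b c d; exact: min_lip.
- move=> f1 f2 lip1 lip2; apply: locally_lipschitz_op lip1 lip2 => L L0.
  exists (L + L * L); first by rewrite addr_ge0 // mulr_ge0.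
  move=> a b c d aL bL cL dL; split.
    by rewrite normrM (le_trans (ler_pM _ _ aL bL)) // lerDr.
  have -> : a * b - c * d = (a - c) * b + c * (b - d) by ring.
  rewrite (le_trans (ler_normD _ _)) // !normrM mulrDr mulrC.
  apply: lerD; apply: ler_wpM2r => //; nra.
Qed.
(** * Functions that vanish on the dual ball *)

(** On the span of [xs], a functional [phi] of norm at most [q] there equals
    [q *: psi] with [psi] in the dual ball. Hence [phi x - psi x] is
    [(q - 1) * psi x] for [x \in xs], and the Lipschitz estimate between [phi]
    and [psi] is proportional to [coord_norm xs phi]: this is precise enough
    near the origin, where a uniform estimate by [e] would be useless. *)
Lemma vanishing_estimate (R : realType) (E : normedModType R) (f : dual E -> R) :
  FAfA E f -> (forall phi, dual_ball phi -> f phi = 0) ->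
  exists xs : seq E, forall e : R, 0 < e ->
    exists q (ys : seq E), [/\ 1 < q, forall y, y \in ys -> `|y| <= 1 &
      forall phi : dual E, (forall y, y \in ys -> `|phi y| < q) ->
        `|f phi| <= e * coord_norm xs phi].
Proof.
move=> /FAfA_locally_lipschitz [xs fP] f0; exists xs => e e0.
(* A functional of norm at most 2 on the span has coord_norm below this radius. *)
have [L L0 {}fP] := fP (2 * \sum_(x <- xs) `|x|).
(* This keeps q below 2 and makes L * (q - 1) at most e. *)
pose q := 1 + e / (L + e).
have Le0 : 0 < L + e by lra.
have q1 : 1 < q by rewrite ltrDl divr_gt0.
have q10 : 0 <= q - 1 by lra.
have q2 : q <= 2.
  by rewrite /q; have : e / (L + e) <= 1; [rewrite ler_pdivrMr //|]; lra.
have Lq : L * (q - 1) <= e.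
  rewrite /q addrC addKr mulrA ler_pdivrMr //.
  by have := mulr_ge0 (ltW e0) (ltW e0); nra.
have [q0 [ys [q01 ysB ysP]]] := lin_span_norming xs q1.
exists q0, ys; split=> // phi /ysP phi_q.
have [|psi [ball_psi phi_psi]] := dual_ball_extension _ phi_q; first by lra.
have psi_le := (dual_ballP psi).1 ball_psi.
have xsphi : coord_norm xs phi <= 2 * \sum_(x <- xs) `|x|.
  rewrite mulr_sumr /coord_norm !big_seq; apply: ler_sum => x xs_x.
  rewrite (le_trans (phi_q _ (mem_lin_span xs_x))) // ler_wpM2r //.
have xspsi : coord_norm xs psi <= 2 * \sum_(x <- xs) `|x|.
  rewrite mulr_sumr /coord_norm; apply: ler_sum => x _.
  by rewrite (le_trans (psi_le x)) // ler_peMl // ler1n.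
have [_] := fP _ _ xsphi xspsi.
rewrite (f0 _ ball_psi) subr0 => /le_trans; apply.
have dist_le : coord_dist xs phi psi <= (q - 1) * coord_norm xs phi.
  rewrite mulr_sumr /coord_dist !big_seq; apply: ler_sum => x xs_x.
  rewrite (phi_psi _ (mem_lin_span xs_x)).
  rewrite -[X in _ - X]mul1r -mulrBl normrM (ger0_norm q10) ler_wpM2l // normrM.
  by rewrite ler_peMl // ger0_norm; lra.
apply: (le_trans (ler_wpM2l L0 dist_le)).
by rewrite mulrA ler_wpM2r // coord_norm_ge0.
Qed.

(** * Admissible seminorms vanish on functions that vanish on the dual ball *)

Lemma FAfA_subalgebra (R : realType) (E : normedModType R) :
  lattice_subalgebra (FAfA E).
Proof.
split.
- by move=> B [[]].
- by move=> f g Af Ag B HB; apply: (lsaD HB.1); [exact: Af|exact: Ag].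
- by move=> a f Af B HB; apply: (lsaZ HB.1); exact: Af.
- by move=> f g Af Ag B HB; apply: (lsa_max HB.1); [exact: Af|exact: Ag].
- by move=> f g Af Ag B HB; apply: (lsa_min HB.1); [exact: Af|exact: Ag].
- by move=> f g Af Ag B HB; apply: (lsaM HB.1); [exact: Af|exact: Ag].
Qed.

Lemma FAfA_delta (R : realType) (E : normedModType R) (x : E) :
  FAfA E (delta x).
Proof. by move=> B [_]; apply; exists x. Qed.

Lemma FAfA_abs (R : realType) (E : normedModType R) (f : dual E -> R) :
  FAfA E f -> FAfA E (fun phi => `|f phi|).
Proof.
move=> Af; have -> : (fun phi => `|f phi|) = f \max (-1 \*o f).
  by apply/funext => phi; rewrite /= mulN1r maxrN.
apply: (lsa_max (FAfA_subalgebra E)) => //.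
exact: (lsaZ (FAfA_subalgebra E)).
Qed.

Lemma FAfA_sum_abs (R : realType) (E : normedModType R) (I : Type) (r : seq I)
    (h : I -> dual E -> R) :
  (forall i, FAfA E (h i)) -> FAfA E (fun phi => \sum_(i <- r) `|h i phi|).
Proof.
move=> Ah; elim: r => [|i r IH].
  under eq_fun do rewrite big_nil; exact: (lsa0 (FAfA_subalgebra E)).
under eq_fun do rewrite big_cons.
exact: (lsaD (FAfA_subalgebra E) (FAfA_abs (Ah i)) IH).
Qed.

Lemma admissible_abs (R : realType) (E : normedModType R)
    (nu : (dual E -> R) -> R) (f : dual E -> R) :
  admissible nu -> FAfA E f -> nu (fun phi => `|f phi|) = nu f.
Proof.
move=> [[_ nu_mono] _ _] Af; have Aabs := FAfA_abs Af.
by apply/eqP; rewrite eq_le !nu_mono // => phi; rewrite normr_id.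
Qed.

Lemma admissible_sum_abs (R : realType) (E : normedModType R)
    (nu : (dual E -> R) -> R) (I : Type) (r : seq I) (h : I -> dual E -> R) :
  admissible nu -> (forall i, FAfA E (h i)) ->
  nu (fun phi => \sum_(i <- r) `|h i phi|) <= \sum_(i <- r) nu (h i).
Proof.
move=> nuP Ah; have [[[nuD nuZ] _] _ _] := nuP.
elim: r => [|i r IH].
  under eq_fun do rewrite big_nil; rewrite big_nil.
  have -> : (fun=> 0) = 0 \*o (cst 0 : dual E -> R).
    by apply/funext => phi /=; rewrite mul0r.
  by rewrite nuZ ?normr0 ?mul0r //; exact: (lsa0 (FAfA_subalgebra E)).
under eq_fun do rewrite big_cons; rewrite big_cons -(admissible_abs nuP (Ah i)).
apply: (le_trans (nuD _ _ (FAfA_abs (Ah i)) (FAfA_sum_abs r Ah))).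
by rewrite lerD2l.
Qed.

Lemma FAfA_delta_exp (R : realType) (E : normedModType R) (y : E) (n : nat)
    (g : dual E -> R) :
  FAfA E g -> FAfA E (fun phi => phi y ^+ n * g phi).
Proof.
move=> Ag; elim: n => [|n IH]; first by under eq_fun do rewrite expr0 mul1r.
under eq_fun do rewrite exprS -mulrA.
exact: (lsaM (FAfA_subalgebra E) (FAfA_delta y) IH).
Qed.

(** The factor [g] is kept because [delta y ^+ 0] is a nonzero constant, which is
    not in the algebra. *)
Lemma admissible_delta_exp (R : realType) (E : normedModType R)
    (nu : (dual E -> R) -> R) (y : E) (n : nat) (g : dual E -> R) :
  admissible nu -> FAfA E g -> `|y| <= 1 ->
  nu (fun phi => phi y ^+ n * g phi) <= nu g.
Proof.
move=> nuP Ag y1; have [_ nuM nu_delta] := nuP.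
elim: n => [|n IH]; first by under eq_fun do rewrite expr0 mul1r.
under eq_fun do rewrite exprS -mulrA.
have An := FAfA_delta_exp y n Ag.
apply: (le_trans (nuM _ _ (FAfA_delta y) An)); apply: le_trans IH.
rewrite ler_piMl ?(le_trans (nu_delta y)) //.
exact: (admissible_ge0 nuP An).
Qed.

Lemma expr_unbounded (R : realType) (q C : R) :
  1 < q -> exists n, C < q ^+ n.
Proof.
move=> q1; have bern n : n%:R * (q - 1) <= q ^+ n.
  elim: n => [|n IH]; first by rewrite mul0r expr0.
  have q_ge1 : 1 <= q ^+ n by rewrite exprn_ege1 // ltW.
  rewrite -natr1 exprS; nra.
exists (Num.truncn (C / (q - 1))).+1; apply: lt_le_trans (bern _).
by rewrite -ltr_pdivrMr ?subr_gt0 //; exact: truncnS_gt.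
Qed.

(** The key point about submultiplicativity: multiplying [g] by [delta y] does
    not increase [nu], whereas on the support of [g] some [`|delta y|] is at
    least [q > 1]; iterating, [q ^+ n * nu g] stays bounded. *)
Lemma admissible_eq0_far (R : realType) (E : normedModType R)
    (nu : (dual E -> R) -> R) (g : dual E -> R) (q : R) (ys : seq E) :
  admissible nu -> FAfA E g -> 1 < q -> (forall y, y \in ys -> `|y| <= 1) ->
  (forall phi, g phi != 0 -> exists2 y, y \in ys & q <= `|phi y|) ->
  nu g = 0.
Proof.
move=> nuP Ag q1 ysB far; have [[[nuD nuZ] nu_mono] _ _] := nuP.
have bound n : q ^+ n * nu g <= (size ys)%:R * nu g.
  pose h (y : E) (phi : dual E) := phi y ^+ n * g phi.
  have Ah y : FAfA E (h y) := FAfA_delta_exp y n Ag.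
  have -> : q ^+ n * nu g = nu (q ^+ n \*o g).
    by rewrite nuZ // ger0_norm // exprn_ge0 //; lra.
  apply: (@le_trans _ _ (nu (fun phi => \sum_(y <- ys) `|h y phi|))).
    apply: nu_mono => [||phi /=].
    - exact: (lsaZ (FAfA_subalgebra E)).
    - exact: FAfA_sum_abs.
    have [->|/far[y ys_y qy]] := eqVneq (g phi) 0; first by rewrite mulr0 normr0.
    rewrite [X in _ <= X]ger0_norm ?sumr_ge0 // (big_rem y) //= /h !normrM.
    rewrite ler_wpDr ?sumr_ge0 // ler_wpM2r // !normrX ger0_norm; last by lra.
    by apply: lerXn2r => //; rewrite nnegrE; lra.
  apply: (le_trans (admissible_sum_abs ys nuP Ah)).
  apply: (@le_trans _ _ (\sum_(y <- ys) nu g)).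
    rewrite !big_seq; apply: ler_sum => y /ysB y1.
    exact: admissible_delta_exp.
  by rewrite big_const_seq count_predT iter_addr_0 mulr_natl.
apply/eqP; rewrite eq_le (admissible_ge0 nuP Ag) andbT leNgt; apply/negP => nug.
have [n] := expr_unbounded (size ys)%:R q1.
by rewrite ltNge -(ler_pM2r nug) bound.
Qed.

Lemma admissible_eq0 (R : realType) (E : normedModType R)
    (nu : (dual E -> R) -> R) (f : dual E -> R) :
  admissible nu -> FAfA E f -> (forall phi, dual_ball phi -> f phi = 0) ->
  nu f = 0.
Proof.
move=> nuP Af f0; have [xs fP] := vanishing_estimate Af f0.
have [[[nuD nuZ] nu_mono] _ _] := nuP; have sub := FAfA_subalgebra E.
have Aw : FAfA E (coord_norm xs).
  by apply: (@FAfA_sum_abs R E E xs (@delta R E)) => x; exact: FAfA_delta.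
have small e : 0 < e -> nu f <= e * nu (coord_norm xs).
  move=> e0; have [q [ys [q1 ysB near]]] := fP e e0.
  have Aew := lsaZ sub e Aw.
  (* The positive part of `|f| - e * coord_norm xs. *)
  pose g := (fun phi => `|f phi|) \max (e \*o coord_norm xs)
    \+ (- 1 \*o (e \*o coord_norm xs)).
  have Ag : FAfA E g.
    apply: (lsaD sub); last exact: (lsaZ sub).
    by apply: (lsa_max sub) => //; exact: FAfA_abs.
  have nug : nu g = 0.
    apply: (admissible_eq0_far nuP Ag q1 ysB) => phi g0.
    apply: contrapT => close; move/eqP: g0; apply.
    rewrite /g /= max_r ?mulN1r ?subrr //; apply: near => y ys_y.
    by rewrite ltNge; apply/negP => qy; apply: close; exists y.
  have -> : e * nu (coord_norm xs) = nu g + nu (e \*o coord_norm xs).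
    by rewrite nug add0r nuZ // gtr0_norm.
  apply: le_trans (nuD _ _ Ag Aew); apply: nu_mono => //; first exact: (lsaD sub).
  by move=> phi; rewrite /g /= mulN1r subrK (le_trans _ (ler_norm _)) // le_max lexx.
apply/eqP; rewrite eq_le (admissible_ge0 nuP Af) andbT.
have w0 := admissible_ge0 nuP Aw.
apply/ler_addgt0Pr => e e0; rewrite add0r.
have w1 : 0 < 1 + nu (coord_norm xs) by lra.
apply: (le_trans (small (e / (1 + nu (coord_norm xs))) _)).
  by rewrite divr_gt0.
by rewrite mulrAC ler_pdivrMr // ler_pM2l //; lra.
Qed.

Lemma admissible_eval (R : realType) (E : normedModType R) (phi : dual E) :
  dual_ball phi -> admissible (fun f : dual E -> R => `|f phi|).
Proof.
move=> /dual_ballP phi_le; split=> //.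
- split; first split.
  + by move=> f g _ _; exact: ler_normD.
  + by move=> a f _ /=; rewrite normrM.
  + by move=> f g _ _.
- by move=> f g _ _ /=; rewrite normrM.
Qed.

Theorem theorem4p10 (R : realType) (E : completeNormedModType R) :
  [set f : dual E -> R | FAfA E f /\ rho f = 0] =
  [set f : dual E -> R | FAfA E f /\
     forall phi : dual E, dual_ball phi -> f phi = 0].
Proof.
apply/seteqP; split=> f [Af f0]; split=> //.
  move=> phi ball_phi; apply/eqP; rewrite -normr_le0 -f0.
  exact: (rho_ub (admissible_eval ball_phi) Af).
exact: admissible_eq0 (@rho_admissible R E) Af f0.
Qed.
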